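(* Any $f$-specification specifies a random field compatible with it. That is, for every $f$-specification ${\rm Q}^f=\{q_V^z, z\in\widehat{X_V^f}, V\in W\}$ there exists a unique (positive) random field $P$ whose $f$-distribution coincides with ${\rm Q}^f$, i.e. such that $$\frac{P_{V\cup S}(xz)}{P_S(z)}=q_V^z(x)$$ for all $V\in W$, all nonempty $S\in W(\mathbb{Z}^d\setminus V)$, and all $x\in X^V$, $z\in X^S$.
   Context: $X\subset\mathbb{R}$ is a finite set with $1<|X|<\infty$, and $d\ge 1$. For $S\subset\mathbb{Z}^d$, $W(S)$ is the set of all finite subsets of $S$, and $W=W(\mathbb{Z}^d)$. $X^S$ is the set of configurations on $S$ (functions $S\to X$), $X^{\emptyset}$ consists of the empty configuration only. For disjoint $S,T$ and $x\in X^S$, $y\in X^T$, $xy\in X^{S\cup T}$ is the concatenation. For $V\in W$, $\widehat{X_V^f}=\bigcup_{\emptyset\neq S\in W(\mathbb{Z}^d\setminus V)}X^S$ is the set of configurations with nonempty finite support outside $V$. A random field is a probability measure $P$ on $X^{\mathbb{Z}^d}$ with the $\sigma$-algebra generated by cylinder sets; $P_V$ denotes its marginal on $X^V$, $V\in W$. All random fields are assumed positive: $P_V(x)>0$ for all $V\in W$, $x\in X^V$. The $f$-distribution of $P$ is the system $\{Q_V^z, z\in\widehat{X_V^f}, V\in W\}$ with $Q_V^z(x)=P_{V\cup S}(xz)/P_S(z)$ for $z\in X^S$. An $f$-specification is a system ${\rm Q}^f=\{q_V^z, z\in\widehat{X_V^f}, V\in W\}$ of strictly positive probability distributions $q_V^z$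 on $X^V$ such that for all disjoint $V,I\in W$ and all $x\in X^V$, $y\in X^I$, $z\in\widehat{X_{V\cup I}^f}$, $$q_{V\cup I}^z(xy)=q_V^z(x)\,q_I^{zx}(y).$$ *)

(* Defs.v *)
From HB Require Import structures.
From mathcomp Require Import all_boot all_order all_algebra finmap.
From mathcomp Require Import all_classical all_reals.
From mathcomp Require Import measure.

Set Implicit Arguments.
Unset Strict Implicit.
Unset Printing Implicit Defensive.

Import Order.TTheory GRing.Theory Num.Theory.
Local Open Scope classical_set_scope.
Local Open Scope fset_scope.
Local Open Scope ring_scope.

Record stateSpace (R : realType) := StateSpace {
  states :> {fset R} ;
  states_gt1 : (1 < #|` states|)%N
}.

(* An alias of the finite type of elements of X: the cardinality condition
   provides the point that the measurable structure on [configSpace d X] requires. *)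
Definition state (R : realType) (X : stateSpace R) : Type :=
  fset_sub_type (states X).

Lemma states_neq0 (R : realType) (X : stateSpace R) :
  exists a : R, a \in states X.
Proof. by apply/fset0Pn; rewrite -cardfs_gt0 (ltn_trans _ (states_gt1 X)). Qed.

HB.instance Definition _ (R : realType) (X : stateSpace R) :=
  Finite.copy (state X) (fset_sub_type (states X)).
HB.instance Definition _ (R : realType) (X : stateSpace R) :=
  isPointed.Build (state X) (FSetSub (xchooseP (states_neq0 X))).

Notation site d := 'rV[int]_d.

(* A finite map carries its domain, so the disjoint union of the X^V over all
   finite V is the type of finite maps, and concatenation is catf, i.e. +. *)
Notation fconf d X := {fmap site d -> state X}.

Definition conf (R : realType) (X : stateSpace R) (d : nat)
    (V : {fset site d}) : {pred fconf d X} :=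
  [pred x | domf x == V].
Arguments conf {R} X {d} V.

Definition extconf (R : realType) (X : stateSpace R) (d : nat)
    (V : {fset site d}) : {pred fconf d X} :=
  [pred z | (domf z != fset0) && [disjoint domf z & V]%fset].
Arguments extconf {R} X {d} V.

Definition restr (R : realType) (X : stateSpace R) (d : nat)
    (V : {fset site d}) (w : site d -> state X) : fconf d X :=
  [fmap t : V => w (val t)]%fmap.

Definition cylinder (R : realType) (X : stateSpace R) (d : nat) :
    set (set (site d -> state X)) :=
  [set A | exists (V : {fset site d}) (B : set (fconf d X)),
             A = restr V @^-1` B].
Arguments cylinder {R} X d.

Notation configSpace d X := (g_sigma_algebraType (cylinder X d)).

Definition marginal (R : realType) (X : stateSpace R) (d : nat)
    (P : probability (configSpace d X) R) (V : {fset site d}) (x : fconf d X) : R :=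
  fine (P [set w | restr V w = x]).

Definition positive_field (R : realType) (X : stateSpace R) (d : nat)
    (P : probability (configSpace d X) R) : Prop :=
  forall (V : {fset site d}) (x : fconf d X),
    x \in conf X V -> 0 < marginal P V x.

(* Systems (q_V^z(x)) are total functions [q V z x]; only the values at
   [x \in conf X V] and [z \in extconf X V] are meaningful. *)
Notation fsystem R d X := ({fset site d} -> fconf d X -> fconf d X -> R).

Definition fdistribution (R : realType) (X : stateSpace R) (d : nat)
    (P : probability (configSpace d X) R) : fsystem R d X :=
  fun V z x =>
    marginal P (V `|` domf z)%fset (x + z)%fset / marginal P (domf z) z.

Definition has_fdistribution (R : realType) (X : stateSpace R) (d : nat)
    (P : probability (configSpace d X) R) (q : fsystem R d X) : Prop :=
  forall (V : {fset site d}) (x z : fconf d X),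
    x \in conf X V -> z \in extconf X V -> fdistribution P V z x = q V z x.

Record fspecification (R : realType) (X : stateSpace R) (d : nat)
    (q : fsystem R d X) : Prop := FSpecification {
  fspec_gt0 : forall (V : {fset site d}) (x z : fconf d X),
    x \in conf X V -> z \in extconf X V -> 0 < q V z x ;
  fspec_sum1 : forall (V : {fset site d}) (z : fconf d X),
    z \in extconf X V ->
    \sum_(x : {ffun V -> state X}) q V z (FinMap x) = 1 ;
  fspec_cat : forall (V I : {fset site d}) (x y z : fconf d X),
    [disjoint V & I]%fset ->
    x \in conf X V -> y \in conf X I -> z \in extconf X (V `|` I)%fset ->
    q (V `|` I)%fset z (x + y)%fset = q V z x * q I (z + x)%fset y
}.

(* Main.v *)
From HB Require Import structures.
Require Import Defs.
From mathcomp Require Import all_boot all_order all_algebra finmap.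
From mathcomp Require Import all_classical all_reals.
From mathcomp Require Import measure filter sequences ereal.
From mathcomp Require Import ring.

Set Implicit Arguments.
Unset Strict Implicit.
Unset Printing Implicit Defensive.

Import Order.TTheory GRing.Theory Num.Theory.
Local Open Scope classical_set_scope.
Local Open Scope ring_scope.

(** The field is built by computing what its marginals must be, checking that
    these values are consistent, and extending them to a measure.

    Write [ratio q x z] for the quotient q_V^z(x) / q_S^x(z), where x and z have
    disjoint nonempty supports V and S.  If P has f-distribution q, then
    P(z) q_V^z(x) = P(xz) = P(x) q_S^x(z), so the ratio equals P(x) / P(z).
    Summing over x in X^V gives 1 / P(z), hence P(z) is forced to be the inverse
    of [normalizer q V z].  This yields uniqueness of the marginals
    ([conditionals_determine_weight]) and, with V reduced to a single site
    outside S, the definition of the candidate marginal [weight].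

    The candidate must not depend on the chosen site.  The cyclic product of
    three conditional probabilities
      q^z(x) q^x(y) q^y(z) = q^z(y) q^y(x) q^x(z)
    holds because each pair can be exchanged in the presence of the third
    configuration; it is [ratio_swap].  Summing it over x and y, where the
    conditional distributions have total mass 1, gives the independence
    ([eq_normalizer]).  A site outside both supports then gives
    weight(xz) = weight(z) q_V^z(x) ([weight_has_conditionals]), from which
    positivity and consistency of the weights follow ([confsum_weight]).

    Consistent weights extend to a probability ([kolmogorov_extension]).  They
    define a finitely additive mass on the algebra of cylinders.  As the state
    space is finite, the configuration space is compact and cylinders are open
    and closed, so a cylinder that is a disjoint union of countably many
    cylinders has only finitely many nonempty terms
    ([cylinder_bigcup_finite]); sigma-additivity on the algebra is thus finite
    additivity, and the Caratheodory extension applies.  Two probabilities with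
    the same marginals agree on cylinders, which are stable under intersection
    and generate the sigma-algebra, so they are equal. *)

(** * Sums over the configurations on a finite set of sites *)

Section FiniteConfigurations.
Context {R : realType} {X : stateSpace R} {d : nat}.
Implicit Types (V I : {fset site d}) (x y z : fconf d X).

Definition confsum V (f : fconf d X -> R) : R :=
  \sum_(x : {ffun V -> state X}) f (FinMap x).

Definition extend x : site d -> state X := fun t => odflt point x.[? t]%fmap.

Lemma conf_domf V x : x \in conf X V -> domf x = V.
Proof. by move/eqP. Qed.

Lemma mem_conf x : x \in conf X (domf x).
Proof. by apply/eqP. Qed.

Lemma conf_FinMap V (x : {ffun V -> state X}) : FinMap x \in conf X V.
Proof. by apply/eqP. Qed.

Lemma conf_catf V I x y : x \in conf X V -> y \in conf X I ->
  (x + y)%fset \in conf X (V `|` I)%fset.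
Proof.
by move=> /conf_domf <- /conf_domf <-; apply/eqP/fsetP => t; rewrite mem_catf inE.
Qed.

Lemma catf_neq0 x y : domf x != fset0 -> domf (x + y)%fset != fset0.
Proof.
by move=> /fset0Pn[t tx]; apply/fset0Pn; exists t; rewrite mem_catf tx.
Qed.

Lemma domf_catf x y : domf (x + y)%fset = (domf x `|` domf y)%fset.
Proof. exact/conf_domf/conf_catf/mem_conf/mem_conf. Qed.

Lemma fnd_restr V (w : site d -> state X) t :
  (restr V w).[? t]%fmap = if t \in V then Some (w t) else None.
Proof.
case: ifPn => tV; last by rewrite not_fnd.
by rewrite in_fnd ffunE.
Qed.

Lemma eq_restr V (w w' : site d -> state X) :
  {in V, w =1 w'} -> restr V w = restr V w'.
Proof.
move=> ww'; apply/fmapP => t; rewrite !fnd_restr.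
by case: ifPn => // tV; rewrite ww'.
Qed.

Lemma restr_inj V (w w' : site d -> state X) :
  restr V w = restr V w' -> {in V, w =1 w'}.
Proof.
move=> /fmapP e t tV; have := e t; rewrite !fnd_restr tV.
by case.
Qed.

Lemma restr_extend V x : x \in conf X V -> restr V (extend x) = x.
Proof.
move=> /conf_domf xV; apply/fmapP => t; rewrite fnd_restr /extend -xV.
by case: ifPn => tx; [rewrite in_fnd|rewrite not_fnd].
Qed.

Lemma extend_FinMap V (x : {ffun V -> state X}) (t : V) :
  extend (FinMap x) (val t) = x t.
Proof. by rewrite /extend -(@Some_fnd _ _ (FinMap x) t). Qed.

Lemma extend_catr x y t : t \in domf y -> extend (x + y)%fset t = extend y t.
Proof. by move=> ty; rewrite /extend fnd_cat ty. Qed.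

Lemma extend_catl x y t : t \notin domf y -> extend (x + y)%fset t = extend x t.
Proof. by move=> /negPf ty; rewrite /extend fnd_cat ty. Qed.

Lemma FinMap_inj V : injective (fun x : {ffun V -> state X} => FinMap x).
Proof.
move=> x y /fmapP xy; apply/ffunP => t.
by rewrite -[LHS]extend_FinMap -[RHS]extend_FinMap /extend xy.
Qed.

Lemma confsum1 V x (f : fconf d X -> R) : x \in conf X V ->
  (forall y, y \in conf X V -> y != x -> f y = 0) -> confsum V f = f x.
Proof.
case: x => [U x] xV; have UV : U = V by exact: conf_domf xV.
subst U => f0.
rewrite /confsum (bigD1 x)//= big1 ?addr0// => y yx; apply: f0 => //.
apply: contraNneq yx => /FinMap_inj ->; exact: eqxx.
Qed.

Lemma conf_fset0 x : x \in conf X fset0 -> x = [fmap]%fmap.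
Proof.
by move=> /restr_extend <-; apply/fmapP=> t; rewrite fnd_restr !not_fnd ?inE.
Qed.

Lemma confsum0 f : confsum fset0 f = f [fmap]%fmap.
Proof.
by apply: confsum1 => [|y /conf_fset0 ->]; [exact/eqP|rewrite eqxx].
Qed.

Lemma eq_confsum V f g : {in conf X V, f =1 g} -> confsum V f = confsum V g.
Proof. by move=> fg; apply: eq_bigr => x _; exact/fg/conf_FinMap. Qed.

Lemma exchange_confsum V I (f : fconf d X -> fconf d X -> R) :
  confsum V (fun x => confsum I (f x)) =
  confsum I (fun y => confsum V (fun x => f x y)).
Proof. exact: exchange_big. Qed.

Lemma confsum_mulr V f c : confsum V f * c = confsum V (fun x => f x * c).
Proof. exact: mulr_suml. Qed.

Lemma confsum_mull V f c : c * confsum V f = confsum V (fun x => c * f x).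
Proof. exact: mulr_sumr. Qed.

(** Concatenation is a bijection from X^V * X^I to X^(V U I): gluing and
    cutting are done on the total functions [extend], which avoids transporting
    finite functions between domains. *)
Lemma confsumU V I f : [disjoint V & I]%fset ->
  confsum (V `|` I)%fset f =
  confsum V (fun x => confsum I (fun y => f (x + y)%fset)).
Proof.
move=> VI; rewrite /confsum pair_bigA /=.
pose glue (p : {ffun V -> state X} * {ffun I -> state X}) :
  {ffun (V `|` I)%fset -> state X} :=
  [ffun t => extend (FinMap p.1 + FinMap p.2)%fset (val t)].
pose cut (w : {ffun (V `|` I)%fset -> state X}) :=
  ([ffun t : V => extend (FinMap w) (val t)],
   [ffun t : I => extend (FinMap w) (val t)]).
have glueE p : FinMap (glue p) = (FinMap p.1 + FinMap p.2)%fset.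
  by rewrite -[RHS](@restr_extend (V `|` I)%fset)// conf_catf ?conf_FinMap.
have glueK : cancel glue cut.
  move=> [x y]; rewrite /cut glueE; congr pair; apply/ffunP => t; rewrite ffunE.
    rewrite extend_catl ?extend_FinMap//=.
    by apply: (fdisjointP VI); exact: valP.
  by rewrite extend_catr ?extend_FinMap//=; exact: valP.
have cutK : cancel cut glue.
  move=> w; apply/ffunP => t; rewrite ffunE /=.
  have [tI|tI] := boolP (val t \in I).
    by rewrite extend_catr//= (extend_FinMap _ [` tI]%fset) ffunE /= extend_FinMap.
  have tV : val t \in V by have := valP t; rewrite inE (negPf tI) orbF.
  rewrite extend_catl//= (extend_FinMap _ [` tV]%fset) ffunE /=.
  by rewrite extend_FinMap.
rewrite (reindex glue) /=; last by exists cut => ? _; [exact: glueK|exact: cutK].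
by apply: eq_bigr => p _; rewrite glueE.
Qed.

End FiniteConfigurations.

(** * The ratios prescribed by a specification *)

Section RatiosOfASpecification.
Context {R : realType} {X : stateSpace R} {d : nat}.
Implicit Types (V I S : {fset site d}) (x y z a : fconf d X) (t : site d).

(** The multiplicative form of having [q] as f-distribution, meaningful for
    weights that are not known to come from a measure. *)
Definition has_conditionals (m : fconf d X -> R) (q : fsystem R d X) :=
  forall V x z, x \in conf X V -> z \in extconf X V ->
    m (x + z)%fset = m z * q V z x.

(** The value that P(x) / P(z) must take if P has f-distribution [q]. *)
Definition ratio (q : fsystem R d X) x z : R :=
  q (domf x) z x / q (domf z) x z.

(** The value that 1 / P(z) must take, whatever the nonempty set [V] disjoint
    from the support of [z]. *)
Definition normalizer (q : fsystem R d X) V z : R :=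
  confsum V (fun a => ratio q a z).

Lemma mem_extconf V z : domf z != fset0 -> [disjoint V & domf z]%fset ->
  z \in extconf X V.
Proof. by move=> z0 Vz; rewrite unfold_in z0 fdisjoint_sym. Qed.

Lemma confsum_gt0 V f : (forall x, x \in conf X V -> 0 < f x) ->
  0 < confsum V f.
Proof.
move=> f0; rewrite lt_neqAle eq_sym sumr_ge0 ?andbT => [|x _]; last first.
  exact/ltW/f0/conf_FinMap.
rewrite psumr_neq0 => [|x _]; last exact/ltW/f0/conf_FinMap.
apply/hasP; exists [ffun _ : V => point : state X].
  exact: mem_index_enum.
by rewrite f0 ?conf_FinMap.
Qed.

(** Both m(z) q^z(x) and m(x) q^x(z) are the weight of the concatenation. *)
Lemma ratio_mul m q x z : has_conditionals m q ->
  domf x != fset0 -> domf z != fset0 -> [disjoint domf x & domf z]%fset ->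
  q (domf z) x z != 0 ->
  m z * ratio q x z = m x.
Proof.
move=> mq x0 z0 xz q0; apply: (mulIf q0).
rewrite /ratio -mulrA divfK// -(mq (domf x)) ?mem_conf ?mem_extconf//.
rewrite disjoint_catfC// (mq (domf z)) ?mem_conf ?mem_extconf//.
by rewrite fdisjoint_sym.
Qed.

Context (q : fsystem R d X) (hq : fspecification q).

Lemma fspec_neq0 x z : domf z != fset0 -> [disjoint domf x & domf z]%fset ->
  q (domf x) z x != 0.
Proof.
by move=> z0 xz; rewrite gt_eqF// (fspec_gt0 hq)// ?mem_conf ?mem_extconf.
Qed.

Lemma ratio_gt0 x z : domf x != fset0 -> domf z != fset0 ->
  [disjoint domf x & domf z]%fset -> 0 < ratio q x z.
Proof.
move=> x0 z0 xz; rewrite divr_gt0// (fspec_gt0 hq) ?mem_conf ?mem_extconf//.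
by rewrite fdisjoint_sym.
Qed.

Lemma confsum_fspec V z : domf z != fset0 -> [disjoint V & domf z]%fset ->
  confsum V (q V z) = 1.
Proof. by move=> z0 Vz; rewrite -(fspec_sum1 hq (mem_extconf z0 Vz)). Qed.

Lemma fspec_chain x y z : domf z != fset0 -> [disjoint domf x & domf y]%fset ->
  [disjoint domf x & domf z]%fset -> [disjoint domf y & domf z]%fset ->
  q (domf x) z x * q (domf y) (z + x)%fset y =
  q (domf x `|` domf y)%fset z (x + y)%fset.
Proof.
move=> z0 xy xz yz; rewrite (fspec_cat hq) ?mem_conf// mem_extconf//.
by rewrite fdisjointUX xz yz.
Qed.

(** The joint conditional distribution of [x] and [y] given [z] can be
    disintegrated in either order. *)
Lemma fspec_swap x y z : domf z != fset0 -> [disjoint domf x & domf y]%fset ->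
  [disjoint domf x & domf z]%fset -> [disjoint domf y & domf z]%fset ->
  q (domf x) z x * q (domf y) (z + x)%fset y =
  q (domf y) z y * q (domf x) (z + y)%fset x.
Proof.
move=> z0 xy xz yz; rewrite !fspec_chain//; last by rewrite fdisjoint_sym.
by rewrite fsetUC disjoint_catfC.
Qed.

(** Cleared of denominators, this is the cyclic identity
    q^z(x) q^x(y) q^y(z) = q^z(y) q^y(x) q^x(z).  It follows by multiplying
    the three exchange relations [fspec_swap], in which each of [x], [y], [z] is
    once the boundary condition: the factors with a two-block boundary occur on
    both sides and cancel. *)
Lemma ratio_swap x y z :
  domf x != fset0 -> domf y != fset0 -> domf z != fset0 ->
  [disjoint domf x & domf y]%fset -> [disjoint domf x & domf z]%fset ->
  [disjoint domf y & domf z]%fset ->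
  ratio q x z * q (domf y) x y = ratio q y z * q (domf x) y x.
Proof.
move=> x0 y0 z0 xy xz yz.
have yx : [disjoint domf y & domf x]%fset by rewrite fdisjoint_sym.
have zx : [disjoint domf z & domf x]%fset by rewrite fdisjoint_sym.
have zy : [disjoint domf z & domf y]%fset by rewrite fdisjoint_sym.
have Ez := fspec_swap z0 xy xz yz.
have Ex := fspec_swap x0 yz yx zx.
have Ey := fspec_swap y0 zx zy xy.
rewrite [(x + z)%fset]disjoint_catfC// in Ex.
rewrite [(y + z)%fset]disjoint_catfC// [(y + x)%fset]disjoint_catfC// in Ey.
have A0 : q (domf y) (z + x)%fset y != 0.
  by rewrite fspec_neq0 ?catf_neq0// domf_catf fdisjointXU; apply/andP.
have B0 : q (domf x) (z + y)%fset x != 0.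
  by rewrite fspec_neq0 ?catf_neq0// domf_catf fdisjointXU; apply/andP.
have C0 : q (domf z) (x + y)%fset z != 0.
  by rewrite fspec_neq0 ?catf_neq0// domf_catf fdisjointXU; apply/andP.
have D0 : q (domf z) x z != 0 by apply: fspec_neq0.
have E0 : q (domf z) y z != 0 by apply: fspec_neq0.
rewrite /ratio mulrAC [RHS]mulrAC; apply/eqP; rewrite eqr_div//; apply/eqP.
apply: (mulIf A0); apply: (mulIf B0); apply: (mulIf C0).
transitivity ((q (domf x) z x * q (domf y) (z + x)%fset y) *
  (q (domf y) x y * q (domf z) (x + y)%fset z) *
  (q (domf z) y z * q (domf x) (z + y)%fset x)); first by ring.
by rewrite Ex Ey Ez; ring.
Qed.

(** Sum [ratio_swap] over both configurations: on each side the conditional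
    distribution sums to 1. *)
Lemma eq_normalizer V I z : V != fset0 -> I != fset0 -> domf z != fset0 ->
  [disjoint V & I]%fset -> [disjoint V & domf z]%fset ->
  [disjoint I & domf z]%fset ->
  normalizer q V z = normalizer q I z.
Proof.
move=> V0 I0 z0 VI Vz Iz.
transitivity (confsum V (fun x => confsum I (fun y => ratio q x z * q I x y))).
  apply: eq_confsum => x /conf_domf xV.
  by rewrite -confsum_mull confsum_fspec ?mulr1 ?xV 1?fdisjoint_sym.
transitivity (confsum I (fun y => confsum V (fun x => ratio q y z * q V y x))).
  rewrite exchange_confsum; apply: eq_confsum => y /conf_domf yI.
  apply: eq_confsum => x /conf_domf xV.
  by rewrite -[in LHS]yI -[in RHS]xV ratio_swap ?xV ?yI.
apply: eq_confsum => y /conf_domf yI.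
by rewrite -confsum_mull confsum_fspec ?mulr1 ?yI.
Qed.

Lemma normalizer_gt0 V z : V != fset0 -> domf z != fset0 ->
  [disjoint V & domf z]%fset -> 0 < normalizer q V z.
Proof.
move=> V0 z0 Vz; apply: confsum_gt0 => a /conf_domf aV.
by apply: ratio_gt0; rewrite ?aV.
Qed.

(** For a weight with conditionals [q] this reads
    q_V^z(x) / P(xz) = 1 / P(z); it holds term by term because
    q^z(x) q^(zx)(a) = q^z(a) q^(za)(x). *)
Lemma normalizer_catf V x z : V != fset0 -> domf z != fset0 ->
  [disjoint domf x & domf z]%fset -> [disjoint V & domf x]%fset ->
  [disjoint V & domf z]%fset ->
  normalizer q V (x + z)%fset * q (domf x) z x = normalizer q V z.
Proof.
move=> V0 z0 xz Vx Vz; rewrite /normalizer confsum_mulr.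
apply: eq_confsum => a /conf_domf aV; subst V.
have xa : [disjoint domf x & domf a]%fset by rewrite fdisjoint_sym.
have za : [disjoint domf z & domf a]%fset by rewrite fdisjoint_sym.
have zx : [disjoint domf z & domf x]%fset by rewrite fdisjoint_sym.
have nz : q (domf x) (a + z)%fset x != 0.
  by rewrite fspec_neq0 ?catf_neq0// domf_catf fdisjointXU xa.
have := fspec_swap z0 xa xz Vz.
rewrite [(z + x)%fset]disjoint_catfC// [(z + a)%fset]disjoint_catfC// => e.
have -> : ratio q a (x + z)%fset = q (domf a) (x + z)%fset a /
    (q (domf z) a z * q (domf x) (a + z)%fset x).
  rewrite fspec_chain// /ratio domf_catf [(x + z)%fset]disjoint_catfC//.
  by rewrite fsetUC.
by rewrite mulrAC [X in X / _]mulrC e invfM mulrACA divff// mulr1.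
Qed.

End RatiosOfASpecification.

(** * The weight of a finite configuration *)

Lemma fset1_neq0 (K : choiceType) (t : K) : [fset t]%fset != fset0.
Proof. by apply/fset0Pn; exists t; rewrite inE. Qed.

(** This is where a positive dimension is needed: the constant vector whose
    entries exceed the sum of the absolute first coordinates in [S] is not
    in [S]. *)
Lemma fresh_site d (S : {fset site d}) : (1 <= d)%N -> exists t, t \notin S.
Proof.
case: d S => // d S _.
pose n : int := \sum_(s <- S) `|s ord0 ord0|.
exists (const_mx (n + 1)); apply/negP => tS.
have : n + 1 <= n.
  rewrite {2}/n (big_fsetD1 _ tS)/= mxE (le_trans (ler_norm _))// lerDl.
  by rewrite sumr_ge0.
by rewrite gerDl ler10.
Qed.

Section Weight.
Context {R : realType} {X : stateSpace R} {d : nat} (hd : (1 <= d)%N).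
Implicit Types (V I S : {fset site d}) (x y z a : fconf d X) (t : site d).

Definition fresh S : site d := projT1 (cid (fresh_site S hd)).

Lemma freshP S : fresh S \notin S.
Proof. exact: projT2 (cid (fresh_site S hd)). Qed.

(** The candidate marginal.  The empty configuration is treated apart, since a
    specification has no conditional distribution with empty boundary. *)
Definition weight (q : fsystem R d X) z : R :=
  if domf z == fset0 then 1 else (normalizer q [fset fresh (domf z)]%fset z)^-1.

(** By [ratio_mul], m(z) times the normalizer is the total mass of [m] on the
    chosen site. *)
Lemma conditionals_determine_weight (m : fconf d X -> R) q z :
  fspecification q -> has_conditionals m q -> (forall V, confsum V m = 1) ->
  domf z != fset0 -> m z = weight q z.
Proof.
move=> hq mq m1 z0; rewrite /weight (negPf z0); set t := fresh _.
have tz : [disjoint [fset t] & domf z]%fset by rewrite fdisjoint1X freshP.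
have n0 := lt0r_neq0 (normalizer_gt0 hq (fset1_neq0 t) z0 tz).
apply: (mulIf n0); rewrite mulVf//.
rewrite -(m1 [fset t]%fset) confsum_mull; apply: eq_confsum => a /conf_domf aE.
have a0 : domf a != fset0 by rewrite aE fset1_neq0.
have az : [disjoint domf a & domf z]%fset by rewrite aE.
by rewrite (ratio_mul mq)// fspec_neq0// fdisjoint_sym.
Qed.

Context (q : fsystem R d X) (hq : fspecification q).

Lemma weight_gt0 z : 0 < weight q z.
Proof.
rewrite /weight; case: ifPn => // z0; rewrite invr_gt0.
by rewrite normalizer_gt0 ?fset1_neq0 ?fdisjoint1X ?freshP.
Qed.

Lemma weightE z t : domf z != fset0 -> t \notin domf z ->
  weight q z = (normalizer q [fset t]%fset z)^-1.
Proof.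
move=> z0 tz; rewrite /weight (negPf z0); set s := fresh _.
have [<-//|st] := eqVneq s t.
by rewrite (@eq_normalizer _ _ _ _ hq [fset s]%fset [fset t]%fset)//
  ?fset1_neq0 ?fdisjoint1X ?freshP// inE.
Qed.

(** A single site outside both supports serves to compute both weights, which
    are then compared by [normalizer_catf]. *)
Lemma weight_has_conditionals : has_conditionals (weight q) q.
Proof.
move=> V x z /conf_domf <- /andP[z0]; rewrite fdisjoint_sym => xz.
pose t := fresh (domf x `|` domf z)%fset.
have := freshP (domf x `|` domf z)%fset; rewrite inE negb_or => /andP[tx tz].
have xz0 : domf (x + z)%fset != fset0 by rewrite disjoint_catfC// catf_neq0.
rewrite (@weightE _ t)//; last by rewrite domf_catf freshP.
rewrite (@weightE z t)//.
rewrite -(normalizer_catf hq (fset1_neq0 t) z0 xz) ?fdisjoint1X//.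
by rewrite invfM divfK // fspec_neq0.
Qed.

(** The sum of ratios to a configuration at another site is on the one hand a
    normalizer, on the other hand the wanted sum divided by a weight. *)
Lemma confsum_weight1 t : confsum [fset t]%fset (weight q) = 1.
Proof.
(* Any configuration away from [t] can serve as reference. *)
pose s := fresh [fset t]%fset; have := freshP [fset t]%fset; rewrite inE => st.
pose z : fconf d X := restr [fset s]%fset (fun=> point).
have z0 : domf z != fset0 by exact: fset1_neq0.
have tz : t \notin domf z by rewrite /= inE eq_sym.
rewrite -(mulVf (lt0r_neq0 (normalizer_gt0 hq (fset1_neq0 t) z0 _))) ?fdisjoint1X//.
rewrite -weightE// confsum_mull; apply: eq_confsum => a /conf_domf aE.
have a0 : domf a != fset0 by rewrite aE fset1_neq0.
have az : [disjoint domf a & domf z]%fset by rewrite aE fdisjoint1X.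
by rewrite (ratio_mul weight_has_conditionals)// fspec_neq0// fdisjoint_sym.
Qed.

Lemma confsum_weight_neq0 V x : domf x != fset0 -> [disjoint V & domf x]%fset ->
  confsum V (fun y => weight q (y + x)%fset) = weight q x.
Proof.
move=> x0 Vx; rewrite -[RHS]mulr1 -(confsum_fspec hq x0 Vx) confsum_mull.
by apply: eq_confsum => y yV; rewrite (weight_has_conditionals yV)// mem_extconf.
Qed.

(** For an empty [x] no conditional distribution is available, and the sum over
    X^V is compared with the sum over one auxiliary site by summing the
    weights on the union in the two orders. *)
Lemma confsum_weight V x : [disjoint V & domf x]%fset ->
  confsum V (fun y => weight q (y + x)%fset) = weight q x.
Proof.
have [x0 _|] := eqVneq (domf x) fset0; last exact: confsum_weight_neq0.
have -> : x = [fmap]%fmap by apply: conf_fset0; apply/eqP.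
have [-> |V0] := eqVneq V fset0; first by rewrite confsum0 catf0.
pose t := fresh V; have tV := freshP V.
rewrite [RHS]/weight eqxx -(confsum_weight1 t).
transitivity (confsum V (fun y => confsum [fset t]%fset
    (fun a => weight q (a + y)%fset))).
  apply: eq_confsum => y /conf_domf yV.
  by rewrite catf0 confsum_weight_neq0 ?yV// fdisjoint1X.
rewrite exchange_confsum; apply: eq_confsum => a /conf_domf aE.
rewrite -[RHS](@confsum_weight_neq0 V) ?aE ?fset1_neq0 ?fdisjointX1//.
apply: eq_confsum => y /conf_domf yV; rewrite disjoint_catfC// aE yV.
by rewrite fdisjoint1X.
Qed.
End Weight.

(** * Cylinders and compactness *)

Section Cylinders.
Context {R : realType} {X : stateSpace R} {d : nat}.
Implicit Types (V I : {fset site d}) (A B : set (site d -> state X)).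

Definition cylinder_on V A := forall w w' : site d -> state X,
  {in V, w =1 w'} -> A w -> A w'.

Lemma cylinderP A : cylinder X d A <-> exists V, cylinder_on V A.
Proof.
split=> [[V [B ->]]|[V AV]]; exists V.
  by move=> w w' ww'; rewrite /preimage /= (eq_restr ww').
exists (restr V @` A); apply/seteqP; split=> [w Aw|w [w' Aw' /restr_inj ww']].
  by exists w.
exact: AV Aw'.
Qed.

Lemma cylinder_on_restr V x :
  cylinder_on V [set w : site d -> state X | restr V w = x].
Proof. by move=> w w' ww' /= <-; apply/esym/eq_restr. Qed.

Lemma cylinder_on_sub V I A : (V `<=` I)%fset -> cylinder_on V A ->
  cylinder_on I A.
Proof.
by move=> /fsubsetP VI AV w w' ww'; apply: AV => t tV; exact/ww'/VI.
Qed.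

Lemma cylinder_onC V A : cylinder_on V A -> cylinder_on V (~` A).
Proof.
by move=> AV w w' ww' nAw Aw'; apply/nAw/(AV w') => // t tV; rewrite ww'.
Qed.

Lemma cylinder_onU V A B : cylinder_on V A -> cylinder_on V B ->
  cylinder_on V (A `|` B).
Proof. by move=> AV BV w w' ww' [/(AV _ _ ww')|/(BV _ _ ww')]; [left|right]. Qed.

Lemma cylinder_set0 : cylinder X d set0.
Proof. by apply/cylinderP; exists fset0 => w w' _ []. Qed.

Lemma cylinderC : setC_closed (cylinder X d).
Proof.
by move=> A /cylinderP[V AV]; apply/cylinderP; exists V; exact: cylinder_onC.
Qed.

Lemma cylinderU : setU_closed (cylinder X d).
Proof.
move=> A B /cylinderP[V AV] /cylinderP[I BI]; apply/cylinderP.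
exists (V `|` I)%fset; apply: cylinder_onU.
  exact: cylinder_on_sub (fsubsetUl _ _) AV.
exact: cylinder_on_sub (fsubsetUr _ _) BI.
Qed.

End Cylinders.

(** An alias of the configuration space whose measurable sets are the cylinders
    themselves, an algebra of sets, and not the generated sigma-algebra. *)
Definition cylinderType (R : realType) (X : stateSpace R) (d : nat) : Type :=
  site d -> state X.

HB.instance Definition _ (R : realType) (X : stateSpace R) (d : nat) :=
  Pointed.on (cylinderType X d).
HB.instance Definition _ (R : realType) (X : stateSpace R) (d : nat) :=
  @isAlgebraOfSets.Build default_measure_display (cylinderType X d)
    (cylinder X d) cylinder_set0 cylinderU cylinderC.

Section Compactness.
Context {R : realType} {X : stateSpace R} {d : nat}.

(** An ultrafilter containing all [C n] selects one state at each site, because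
    there are finitely many states.  The selected configuration agrees, on any
    finite set of sites, with the members of a set of the ultrafilter, and so
    with a point of [C n]; hence it lies in the cylinder [C n]. *)
Lemma cylinder_compact (C : nat -> set (site d -> state X)) :
  (forall n, cylinder X d (C n)) ->
  (forall n, \bigcap_(k in `I_n) C k !=set0) -> \bigcap_n C n !=set0.
Proof.
move=> Ccyl Cfin.
pose F := filter_from [set: nat] (fun n => \bigcap_(k in `I_n) C k).
have PF : ProperFilter F.
  apply: filter_from_proper => [|n _]; last exact: Cfin.
  apply: filter_from_filter => [|i j _ _]; first by exists 0%N.
  by exists (maxn i j) => // w Cw; split=> k /= kij; apply: Cw => /=;
    rewrite leq_max kij ?orbT.
have [U [UU FU]] := ultraFilterLemma PF.
have Uval t : exists a : state X, U [set w | w t = a].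
  apply: contrapT => /forallNP nU.
  have : U [set w | forall a : state X, w t <> a].
    apply: (@filter_forall _ (state X) (fun a w => w t <> a)) => a.
    by have [/nU|] := @in_ultra_setVsetC _ U [set w | w t = a] UU.
  by move/filter_ex => [w /(_ (w t))].
have [v Uv] := choice Uval.
exists v => n _; have /cylinderP[V CV] := Ccyl n.
have UC : U (C n).
  by apply: FU; exists n.+1 => // w; apply => /=.
(* Finitely many sites: agreement with [v] on all of [V] is in [U]. *)
have UV : U [set w | forall t : V, w (val t) = v (val t)].
  apply: (@filter_forall _ V (fun t w => w (val t) = v (val t))) => t.
  exact: Uv.
have [w [Cw wv]] := filter_ex (filterI UC UV).
by apply: CV Cw => t tV; exact: (wv [` tV]%fset).
Qed.

(** Apply compactness to the cylinders obtained by removing each [F n] from the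
    union: finitely many [F n] cover it, and the other ones, being disjoint
    from these, are empty. *)
Lemma cylinder_bigcup_finite (F : nat -> set (site d -> state X)) :
  (forall n, cylinder X d (F n)) -> cylinder X d (\bigcup_n F n) ->
  trivIset setT F -> exists n, forall m, (n <= m)%N -> F m = set0.
Proof.
move=> Fcyl Ucyl tF.
pose C n : set (site d -> state X) := (\bigcup_n F n) `\` F n.
have Ccyl n : cylinder X d (C n).
  exact: (@measurableD _ (cylinderType X d) _ _ Ucyl (Fcyl n)).
have [n /set0P/negP/negPn/eqP Cn] : exists n, ~ (\bigcap_(k in `I_n) C k !=set0).
  apply/existsNP => /(cylinder_compact Ccyl)[w Cw].
  by have [[k _ Fk] _] := Cw 0%N I; have [_ /(_ Fk)] := Cw k I.
exists n => m nm; apply/seteqP; split=> // w Fw.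
suff : (\bigcap_(k in `I_n) C k) w by rewrite Cn.
move=> k /= kn; split=> [|Fk]; first by exists m.
have mk : m = k by apply: tF => //; exists w.
by move: kn; rewrite -mk ltnNge nm.
Qed.

End Compactness.

(** * Extension of consistent weights to a probability *)

Section KolmogorovExtension.
Context {R : realType} {X : stateSpace R} {d : nat}.
Implicit Types (V I : {fset site d}) (A B : set (site d -> state X)).
Context (p : fconf d X -> R).
Context (p_ge0 : forall x, 0 <= p x).
Context (p_empty : p [fmap]%fmap = 1).
Context (p_consistent : forall V x, [disjoint V & domf x]%fset ->
  confsum V (fun y => p (y + x)%fset) = p x).

Definition mass_on V A : R := confsum V (fun x => p x * (extend x \in A)%:R).

(** By [massE] the value does not depend on the base chosen by [xget]. *)
Definition mass A : R := mass_on (xget fset0 [set V | cylinder_on V A]) A.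

(** Whether the configuration belongs to [A] is decided by the part on [V], so
    the sum over the part on [I] only involves the weights, which are
    consistent. *)
Lemma mass_on_fsetU V I A : [disjoint V & I]%fset -> cylinder_on V A ->
  mass_on (V `|` I)%fset A = mass_on V A.
Proof.
move=> VI AV; rewrite /mass_on confsumU//; apply: eq_confsum => x /conf_domf xV.
have Ix : [disjoint I & domf x]%fset by rewrite xV fdisjoint_sym.
rewrite -(p_consistent Ix) confsum_mulr; apply: eq_confsum => y /conf_domf yI.
rewrite disjoint_catfC ?xV ?yI//; congr (_ * (nat_of_bool _)%:R).
have e : {in V, extend (y + x)%fset =1 extend x}.
  by move=> t tV; rewrite extend_catr ?xV.
apply/idP/idP; rewrite !inE; apply: AV => // t tV.
by rewrite e.
Qed.

Lemma mass_onE V I A : cylinder_on V A -> cylinder_on I A ->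
  mass_on V A = mass_on I A.
Proof.
have VDI V' I' : [disjoint V' & I' `\` V']%fset.
  by apply/fdisjointP => t tV'; rewrite inE tV'.
have VUD V' I' : (V' `|` (I' `\` V') = V' `|` I')%fset.
  by apply/fsetP => t; rewrite !inE; case: (_ \in V').
move=> AV AI; rewrite -(mass_on_fsetU (VDI V I) AV) -(mass_on_fsetU (VDI I V) AI).
by rewrite !VUD fsetUC.
Qed.

Lemma massE V A : cylinder_on V A -> mass A = mass_on V A.
Proof.
move=> AV; apply: mass_onE => //.
by apply: (@xgetPex _ _ [set V' | cylinder_on V' A]); exists V.
Qed.

Lemma mass_ge0 A : 0 <= mass A.
Proof. by apply: sumr_ge0 => x _; rewrite mulr_ge0. Qed.

Lemma mass_set0 : mass set0 = 0.
Proof. by apply: big1 => x _; rewrite in_set0 mulr0. Qed.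

Lemma mass_setT : mass setT = 1.
Proof.
by rewrite (@massE fset0)// /mass_on confsum0 p_empty in_setT mulr1.
Qed.

Lemma mass_restr V x : x \in conf X V -> mass [set w | restr V w = x] = p x.
Proof.
move=> xV; rewrite (massE (@cylinder_on_restr _ _ _ _ x)).
rewrite /mass_on (confsum1 xV); last first.
  move=> y yV yx; rewrite memNset ?mulr0//= restr_extend//.
  by move=> /eqP; rewrite (negPf yx).
by rewrite mem_set ?mulr1//= restr_extend.
Qed.

Lemma massU A B : cylinder X d A -> cylinder X d B -> A `&` B = set0 ->
  mass (A `|` B) = mass A + mass B.
Proof.
move=> /cylinderP[V AV] /cylinderP[I BI] AB.
have {}AV := cylinder_on_sub (fsubsetUl V I) AV.
have {}BI := cylinder_on_sub (fsubsetUr V I) BI.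
rewrite (massE AV) (massE BI) (massE (cylinder_onU AV BI)).
rewrite /mass_on /confsum -big_split/=; apply: eq_bigr => x _.
rewrite -mulrDr in_setU -natrD; congr (_ * _%:R).
have := in_set0 (extend (FinMap x)); rewrite -AB in_setI.
by case: (_ \in A); case: (_ \in B).
Qed.

Definition premeasure (A : set (cylinderType X d)) : \bar R := (mass A)%:E.

(** The partial sums are masses of finite unions, and these unions are constant
    from some rank on by compactness. *)
Lemma premeasure_sigma_additive : semi_sigma_additive premeasure.
Proof.
move=> F Fcyl tF Ucyl.
have [n Fn] := cylinder_bigcup_finite Fcyl Ucyl tF.
have sumF m : (\sum_(0 <= i < m) premeasure (F i) =
    premeasure (\big[setU/set0]_(i < m) F i))%E.
  elim: m => [|m IH]; first by rewrite big_nil big_ord0 /premeasure mass_set0.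
  rewrite big_nat_recr//= IH big_ord_recr /premeasure massU ?EFinD//.
  - by apply: (@bigsetU_measurable _ (cylinderType X d)) => i _; exact: Fcyl.
  - exact: Fcyl.
  apply/seteqP; split=> // w [].
  rewrite -bigcup_mkord => -[k /= km Fk] Fm.
  have := tF k m I I; rewrite -/(_ !=set0) => /(_ (ex_intro _ w (conj Fk Fm))) e.
  by move: km; rewrite e ltnn.
have UF m : (n <= m)%N -> \big[setU/set0]_(i < m) F i = \bigcup_i F i.
  move=> nm; rewrite -bigcup_mkord; apply/seteqP; split=> w [k km Fk].
    by exists k.
  exists k => //=; rewrite ltnNge; apply/negP => mk.
  by move: Fk; rewrite Fn// (leq_trans nm).
(* Shifting the index by [n] makes the sequence of partial sums constant. *)
rewrite -(cvg_shiftn n) /=.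
rewrite (_ : (fun m : nat => _) = cst (premeasure (\bigcup_i F i))).
  exact: cvg_cst.
by apply/funext => m; rewrite sumF UF// leq_addl.
Qed.

Lemma premeasure_set0 : premeasure set0 = 0%E.
Proof. by rewrite /premeasure mass_set0. Qed.

Lemma premeasure_ge0 A : (0 <= premeasure A)%E.
Proof. by rewrite lee_fin mass_ge0. Qed.

HB.instance Definition _ := isMeasure.Build default_measure_display
  (cylinderType X d) R premeasure
  premeasure_set0 premeasure_ge0 premeasure_sigma_additive.

Definition extension : set (configSpace d X) -> \bar R :=
  measure_extension premeasure.

Let extension0 : extension set0 = 0%E.
Proof. exact: (measure0 (measure_extension premeasure)). Qed.

Let extension_ge0 A : (0 <= extension A)%E.
Proof. exact: (measure_ge0 (measure_extension premeasure)). Qed.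

Let extension_sigma_additive : semi_sigma_additive extension.
Proof.
exact: (@measure_semi_sigma_additive _ _ _ (measure_extension premeasure)).
Qed.

HB.instance Definition _ := isMeasure.Build _ _ _ extension
  extension0 extension_ge0 extension_sigma_additive.

Lemma extensionE A : cylinder X d A -> extension A = (mass A)%:E.
Proof. exact: (@measurable_mu_extE _ R (cylinderType X d) premeasure A). Qed.

Lemma extension_setT : extension setT = 1%E.
Proof. by rewrite extensionE ?mass_setT//; apply/cylinderP; exists fset0. Qed.

HB.instance Definition _ := Measure_isProbability.Build _ _ R
  extension extension_setT.

(** The extension agrees with [mass] on cylinders, and a marginal is its value
    on a cylinder of the form restr V w = x, which carries the mass [p x]. *)
Theorem kolmogorov_extension : exists P : probability (configSpace d X) R,
  forall V x, x \in conf X V -> marginal P V x = p x.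
Proof.
exists extension => V x xV; rewrite /marginal /=.
rewrite extensionE ?mass_restr//=.
by exists V, [set x].
Qed.
End KolmogorovExtension.

(** * Marginals determine a random field *)

Section Marginals.
Context {R : realType} {X : stateSpace R} {d : nat}.
Implicit Types (P : probability (configSpace d X) R) (V : {fset site d}).
Implicit Types A : set (site d -> state X).

Lemma measurable_cylinder_on V A : cylinder_on V A ->
  measurable (A : set (configSpace d X)).
Proof. by move=> AV; apply: sub_sigma_algebra; apply/cylinderP; exists V. Qed.

Lemma marginalE P V x : (marginal P V x)%:E = P [set w | restr V w = x].
Proof.
rewrite /marginal fineK// fin_num_measure//.
exact: measurable_cylinder_on (@cylinder_on_restr _ _ _ _ x).
Qed.

(** A cylinder on [V] is the disjoint union of its traces on the finitely many
    elementary cylinders over X^V, and each trace is empty or the whole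
    elementary cylinder. *)
Lemma cylinder_probability P V A : cylinder_on V A ->
  P A = (confsum V (fun x => marginal P V x * (extend x \in A)%:R))%:E.
Proof.
move=> AV.
pose F (x : {ffun V -> state X}) : set (configSpace d X) :=
  [set w | restr V w = FinMap x] `&` A.
have mF x : measurable (F x).
  apply: measurableI; last exact: measurable_cylinder_on AV.
  exact: measurable_cylinder_on (@cylinder_on_restr _ _ _ _ _).
have AF : A = \bigcup_x F x.
  apply/seteqP; split=> [w Aw|w [x _ []]//].
  by exists [ffun t : V => w (val t)].
rewrite [in LHS]AF measure_fin_bigcup//; first last.
- by move=> x y _ _ [w [[/= wx _] [/= wy _]]]; apply: FinMap_inj; rewrite -wx.
- exact: finite_finset.
rewrite (fsbigE (index_enum {ffun V -> state X})) ?index_enum_uniq//; last first.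
  by move=> x _; rewrite mem_index_enum.
rewrite /confsum -sumEFin; apply: eq_big => [x|x _]; first exact: in_setT.
have [xA|xA] := boolP (extend (FinMap x) \in A).
  rewrite mulr1 marginalE; congr (P _); apply/seteqP; split=> [w []//|w /= wx].
  split=> //; move: xA; rewrite inE; apply: AV; apply: restr_inj.
  by rewrite restr_extend ?conf_FinMap.
rewrite mulr0 (_ : F x = set0) ?measure0//; apply/seteqP; split=> // w [/= wx Aw].
move: xA; apply/negP/negPn; rewrite inE; apply: AV Aw; apply: restr_inj.
by rewrite restr_extend ?conf_FinMap.
Qed.
End Marginals.

(** * Random fields specified by an f-specification *)

Theorem theorem2 (R : realType) (X : stateSpace R) (d : nat) (hd : (1 <= d)%N)
    (q : fsystem R d X) (hq : fspecification q) :
  exists P : probability (configSpace d X) R,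
    [/\ positive_field P, has_fdistribution P q &
        forall P' : probability (configSpace d X) R,
          positive_field P' -> has_fdistribution P' q ->
          forall A : set (configSpace d X), measurable A -> P' A = P A].
Proof.
have [] := @kolmogorov_extension R X d (weight hd q).
- by move=> x; exact/ltW/weight_gt0.
- by rewrite /weight eqxx.
- by move=> V x; exact: confsum_weight.
move=> P Pw; exists P; split.
- by move=> V x xV; rewrite Pw// weight_gt0.
- move=> V x z xV zV; rewrite /fdistribution !Pw ?mem_conf//; last first.
    by rewrite conf_catf// mem_conf.
  by rewrite (weight_has_conditionals hd hq xV zV) mulrC mulKf// gt_eqF// weight_gt0.
move=> P' P'_gt0 P'q.
pose m x := marginal P' (domf x) x.
have mE V x : x \in conf X V -> m x = marginal P' V x by move=> /conf_domf <-.
have mq : has_conditionals m q.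
  move=> V x z xV zV; rewrite -(P'q V x z)// /fdistribution.
  rewrite mulrC divfK; first by rewrite (@mE (V `|` domf z)%fset)// conf_catf// mem_conf.
  by rewrite gt_eqF// P'_gt0// mem_conf.
have m1 V : confsum V m = 1.
  apply: EFin_inj; rewrite -(probability_setT P') (@cylinder_probability _ _ _ P' V)//.
  by congr EFin; apply: eq_confsum => x xV; rewrite in_setT mulr1 (mE V).
have mw x : m x = weight hd q x.
  have [x0|x0] := eqVneq (domf x) fset0; last exact: conditionals_determine_weight.
  rewrite (@conf_fset0 _ _ _ x); last exact/eqP.
  by rewrite -confsum0 m1 /weight eqxx.
have agree V B : cylinder_on V B -> P' B = P B.
  move=> BV; rewrite !(cylinder_probability _ BV); congr EFin.
  by apply: eq_confsum => x xV; rewrite Pw// -mE// mw.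
move=> A mA.
apply: (@measure_unique _ R (configSpace d X) (cylinder X d) (fun=> setT)) => //.
- by move=> B C cB cC; apply: (@measurableI _ (cylinderType X d)).
- by move=> _; apply/cylinderP; exists fset0.
- by rewrite bigcup_const//; exists 0%N.
- by move=> B /cylinderP[V BV]; exact: agree BV.
- by move=> _; rewrite /= probability_setT ltry.
Qed.
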